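(* There is an absolute constant $c>0$ such that for every $f\in C[0,1]$, with $g(x):=f(1-x)$, and every integer $n\ge1$: (1) for every $q>1$, $$\|R_{n,q}(f)-R_{\infty,q}(f)\|\le c\,\omega_2\!\left(g,\sqrt{q^{-n}}\right);$$ (2) moreover, $$\sup_{1\le q<\infty}\|R_{n,q}(f)-R_{\infty,q}(f)\|\le c\,\omega_2\!\left(g,n^{-1/2}\right).$$
   Context: For $q>0$ and an integer $n\ge 0$: $[n]=1+q+\dots+q^{n-1}$, $[0]=0$; $[n]!=[1][2]\cdots[n]$, $[0]!=1$; for $0\le k\le n$ let ${n\brack k}=\frac{[n]!}{[k]!\,[n-k]!}$. The Lupaş $q$-analogue of the Bernstein operator is, for $q>0$, $f\in C[0,1]$, $x\in[0,1]$, $n\ge1$, $$R_{n,q}(f,x)=\sum_{k=0}^{n} f\!\left(\tfrac{[k]}{[n]}\right) {n\brack k}\frac{q^{k(k-1)/2}x^{k}(1-x)^{n-k}}{(1-x+qx)\cdots(1-x+q^{n-1}x)}.$$ For $0<q<1$ the limit $q$-Lupaş operator is $R_{\infty,q}(f,x)=\sum_{k=0}^{\infty} f(1-q^{k})\,b_{\infty k}(q;x)$ if $x\in[0,1)$ and $R_{\infty,q}(f,1)=f(1)$, where $$b_{\infty k}(q;x)=\frac{q^{k(k-1)/2}\,(x/(1-x))^{k}}{(1-q)^{k}[k]!\prod_{j=0}^{\infty}\left(1+q^{j}\,x/(1-x)\right)}.$$ For $q>1$, $R_{\infty,q}(f,x)=R_{\infty,1/q}(g,1-x)$ with $g(x)=f(1-x)$;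 for $q=1$, $R_{\infty,1}(f)=f$. Known fact (Ostrovska): for $q>1$, $R_{n,q}(f,x)=R_{n,1/q}(g,1-x)$. $\|\cdot\|$ is the supremum norm on $C[0,1]$. The second modulus of smoothness is $\omega_2(f,t)=\sup_{0\le h\le t}\ \sup_{0\le x\le 1-2h}|f(x+2h)-2f(x+h)+f(x)|$ (the suprema being over $h$ with $2h\le 1$). *)

(* Defs.v *)
From HB Require Import structures.
From mathcomp Require Import all_boot all_order all_algebra.
From mathcomp Require Import all_classical all_reals all_analysis.
Set Implicit Arguments.
Unset Strict Implicit.
Unset Printing Implicit Defensive.
Import Order.TTheory GRing.Theory Num.Theory.
Import numFieldNormedType.Exports.
Local Open Scope classical_set_scope.
Local Open Scope ring_scope.

(* Elements of C[0,1] are represented by functions f : R -> R that are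
   continuous within `[0, 1]; the values of f outside [0,1] are never used. *)

Definition qint (R : realType) (q : R) (n : nat) : R := \sum_(0 <= i < n) q ^+ i.

Definition qfact (R : realType) (q : R) (n : nat) : R :=
  \prod_(1 <= i < n.+1) qint q i.

Definition qbinom (R : realType) (q : R) (n k : nat) : R :=
  qfact q n / (qfact q k * qfact q (n - k)).

Definition lupas (R : realType) (n : nat) (q : R) (f : R -> R) (x : R) : R :=
  \sum_(0 <= k < n.+1)
    f (qint q k / qint q n) *
    (qbinom q n k *
     (q ^+ (k * (k - 1))./2 * x ^+ k * (1 - x) ^+ (n - k) /
      \prod_(1 <= j < n) (1 - x + q ^+ j * x))).

(* Meant for 0 < q < 1 and 0 <= x < 1, where the infinite product converges. *)
Definition limit_lupas_basis (R : realType) (q : R) (k : nat) (x : R) : R :=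
  q ^+ (k * (k - 1))./2 * (x / (1 - x)) ^+ k /
  ((1 - q) ^+ k * qfact q k *
   limn (fun m => \prod_(0 <= j < m) (1 + q ^+ j * (x / (1 - x))))).

(* The limit operator for 0 < q < 1. *)
Definition limit_lupas_lt1 (R : realType) (q : R) (f : R -> R) (x : R) : R :=
  if x == 1 then f 1
  else limn (series (fun k => f (1 - q ^+ k) * limit_lupas_basis q k x)).

Definition limit_lupas (R : realType) (q : R) (f : R -> R) (x : R) : R :=
  if q < 1 then limit_lupas_lt1 q f x
  else if q == 1 then f x
  else limit_lupas_lt1 q^-1 (fun y => f (1 - y)) (1 - x).

(* The suprema are taken in \bar R, since [sup] on R is 0 on unbounded sets. *)
Definition supnorm01 (R : realType) (f : R -> R) : \bar R :=
  ereal_sup [set `|f x|%:E | x in `[0, 1]].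

Definition omega2 (R : realType) (f : R -> R) (t : R) : \bar R :=
  ereal_sup
    [set ereal_sup [set `|f (x + 2 * h) - 2 * f (x + h) + f x|%:E
                   | x in `[0, 1 - 2 * h]]
    | h in [set h : R | 0 <= h <= t /\ 2 * h <= 1]].

(* Main.v *)
Require Import Defs.
From HB Require Import structures.
From mathcomp Require Import all_boot all_order all_algebra.
From mathcomp Require Import all_classical all_reals all_analysis.
From mathcomp Require Import ring lra zify.
Set Implicit Arguments.
Unset Strict Implicit.
Unset Printing Implicit Defensive.
Import Order.TTheory GRing.Theory Num.Theory.
Import numFieldNormedType.Exports.
Local Open Scope classical_set_scope.
Local Open Scope ring_scope.

(* For q > 1 the operators reflect to those with p = 1/q < 1, applied to g at 1 - x,
   so take 0 < q <= 1. Writing the Lupas operator L_n as an average of itself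
   under degree raising shows that L_n decreases with n on convex functions;
   passing to the limit on partial sums (Fatou) gives L_inf phi <= L_n phi for
   the hinge functions phi = max(0, x - c). Both operators are positive, preserve
   affine functions, and L_n (t^2) - L_inf (t^2) <= q^n / [n] <= min(q^n, 1/n).
   Replace g by its piecewise linear interpolant s at the nodes i/m: this costs
   at most omega_2(g, 1/m), and s is an affine function plus hinges whose
   coefficients are m times second differences. As all differences
   (L_n - L_inf)(hinge) are nonnegative, their sum is controlled by the same
   quantity for the interpolant of t^2, hence by the second moment bound. Taking m
   of order 1/t, where t^2 bounds the second moment difference, gives c = 6. *)

(** * Piecewise linear interpolation *)

Section HingeInterpolation.
Variable R : realType.
Implicit Types (f u : R -> R) (a b w x y h : R) (m i j : nat).

Definition hinge a x : R := Num.max 0 (x - a).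

Lemma hinge_ge0 a x : 0 <= hinge a x.
Proof. by rewrite /hinge le_max lexx. Qed.

Lemma hinge_left a x : x <= a -> hinge a x = 0.
Proof. by move=> xa; rewrite /hinge max_l// subr_le0. Qed.

Lemma hinge_right a x : a <= x -> hinge a x = x - a.
Proof. by move=> ax; rewrite /hinge max_r// subr_ge0. Qed.

Lemma hinge_convex a w x y : 0 <= w -> w <= 1 ->
  hinge a ((1 - w) * x + w * y) <= (1 - w) * hinge a x + w * hinge a y.
Proof.
move=> w0 w1; have u0 : 0 <= 1 - w by rewrite subr_ge0.
have le_hinge z : z - a <= hinge a z by rewrite /hinge le_max lexx orbT.
rewrite {1}/hinge ge_max addr_ge0 ?mulr_ge0 ?hinge_ge0//=.
have := ler_wpM2l u0 (le_hinge x); have := ler_wpM2l w0 (le_hinge y).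
lra.
Qed.

Lemma continuous_hinge a : continuous (hinge a).
Proof.
move=> x; apply: (@continuous_max R R (fun=> 0) (fun x => x - a)).
  exact: cvg_cst.
by apply: cvgB; [exact: cvg_id|exact: cvg_cst].
Qed.

(* At a maximum [c] of [|u|], the second difference centred at [c] whose outer
   nodes are the nearest endpoint and its reflection is at least [|u c|]. *)
Lemma le_second_difference u a b w : a <= b ->
  {within `[a, b], continuous u} -> u a = 0 -> u b = 0 ->
  (forall x h, 0 <= h -> a <= x -> x + 2 * h <= b ->
    `|u (x + 2 * h) - 2 * u (x + h) + u x| <= w) ->
  forall x, a <= x <= b -> `|u x| <= w.
Proof.
move=> ab cu ua ub uw x xab.
have cnu : {within `[a, b], continuous (fun y => `|u y|)}.
  by move=> y; apply: cvg_norm; exact: cu.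
have [c cab umax] := EVT_max ab cnu.
apply: le_trans (umax x _) _; first by rewrite in_itv.
move: cab; rewrite in_itv/= => /andP[ac cb].
have [cmid|cmid] := leP (2 * c) (a + b).
- have := uw a (c - a); rewrite subr_ge0 lexx (_ : a + 2 * (c - a) = 2 * c - a); last by ring.
  rewrite (_ : a + (c - a) = c); last by ring.
  have d : 2 * c - a <= b by lra.
  move=> /(_ ac isT d); rewrite ua addr0.
  have : `|u (2 * c - a)| <= `|u c| by apply: umax; rewrite in_itv/=; apply/andP; split; lra.
  have := ler_normB (u (2 * c - a)) (u (2 * c - a) - 2 * u c).
  rewrite subKr normrM (ger0_norm (_ : 0 <= 2 :> R))//; lra.
- have cb0 : 0 <= b - c by lra.
  have := uw (2 * c - b) (b - c) cb0.
  rewrite (_ : 2 * c - b + 2 * (b - c) = b); last by ring.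
  rewrite (_ : 2 * c - b + (b - c) = c); last by ring.
  have d : a <= 2 * c - b by lra.
  move=> /(_ d (lexx _)); rewrite ub sub0r.
  have : `|u (2 * c - b)| <= `|u c| by apply: umax; rewrite in_itv/=; apply/andP; split; lra.
  have := ler_normB (u (2 * c - b)) (- (2 * u c) + u (2 * c - b)).
  rewrite opprD opprK addrCA subrr addr0.
  rewrite normrM (ger0_norm (_ : 0 <= 2 :> R))//; lra.
Qed.

Definition node_difference m f i : R :=
  f (i.+1%:R / m%:R) - 2 * f (i%:R / m%:R) + f (i.-1%:R / m%:R).

(** The slope on the first cell is [m%:R * (f m%:R^-1 - f 0)]; at each interior node it jumps by
    [m%:R] times the second difference there, which is the coefficient of the hinge with that
    corner. *)
Definition hinge_interp m f x : R :=
  f 0 + m%:R * (f m%:R^-1 - f 0) * x +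
  \sum_(1 <= i < m) m%:R * node_difference m f i * hinge (i%:R / m%:R) x.

Lemma continuous_hinge_interp m f : continuous (hinge_interp m f).
Proof.
move=> x; apply: cvgD.
  apply: cvgD; first exact: cvg_cst.
  by apply: cvgM; [exact: cvg_cst|exact: cvg_id].
apply: cvg_big => [|i _]; first exact: add_continuous.
apply: cvgM; first exact: cvg_cst.
exact: continuous_hinge.
Qed.

(** Second differences telescope to the last first difference minus the one on the first cell. *)
Lemma sum_node_difference m f j :
  \sum_(1 <= i < j.+1) node_difference m f i =
  f (j.+1%:R / m%:R) - f (j%:R / m%:R) - (f m%:R^-1 - f 0).
Proof.
elim: j => [|j IHj]; first by rewrite big_geq// mul0r div1r subrr.
by rewrite big_nat_recr//= IHj /node_difference /=; ring.
Qed.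

Lemma hinge_step m i j : (0 < m)%N ->
  hinge (i%:R / m%:R) (j.+1%:R / m%:R) - hinge (i%:R / m%:R) (j%:R / m%:R) =
  (i <= j)%:R / m%:R.
Proof.
move=> m0; have mgt0 : 0 < m%:R :> R by rewrite ltr0n.
have le_node k l : (k <= l)%N -> k%:R / m%:R <= l%:R / m%:R :> R.
  by move=> kl; rewrite ler_pM2r ?invr_gt0// ler_nat.
have [ij|ji] := leqP i j.
  by rewrite !hinge_right ?le_node// ?leqW// -[j.+1%:R]natr1 /=; ring.
by rewrite !hinge_left ?le_node// 1?ltnW//=; ring.
Qed.

(** Induction on [j]: from node [j] to the next one only the hinges with [i <= j] grow, each by 1/m,
    and their coefficients telescope to the increment of [f]. *)
Lemma hinge_interp_node m f j : (j <= m)%N -> (0 < m)%N ->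
  hinge_interp m f (j%:R / m%:R) = f (j%:R / m%:R).
Proof.
move=> + m0; have mneq0 : m%:R != 0 :> R by rewrite pnatr_eq0 -lt0n.
have mgt0 : 0 < m%:R :> R by rewrite ltr0n.
elim: j => [_|j IHj jm].
  rewrite mul0r /hinge_interp mulr0 addr0 big_nat big1 ?addr0// => i _.
  by rewrite hinge_left ?mulr0// divr_ge0.
have step : hinge_interp m f (j.+1%:R / m%:R) - hinge_interp m f (j%:R / m%:R) =
    f (j.+1%:R / m%:R) - f (j%:R / m%:R).
  rewrite /hinge_interp opprD addrACA -sumrB.
  under eq_bigr do rewrite -mulrBr hinge_step//.
  rewrite (big_cat_nat (n := j.+1))//= [X in _ + (_ + X)]big_nat.
  rewrite [X in _ + (_ + X)]big1 => [|i /andP[ji _]]; last first.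
    by rewrite leqNgt ji mul0r mulr0.
  rewrite addr0 (eq_big_nat _ _ (F2 := node_difference m f)).
    rewrite sum_node_difference -[j.+1%:R]natr1.
    have alg (A B C M J : R) : M != 0 ->
        A + M * B * ((J + 1) / M) - (A + M * B * (J / M)) + (C - B) = C.
      by move=> M0; field.
    exact: alg.
  by move=> i /andP[_ ij]; rewrite -ltnS ij /= div1r mulrAC divff// mul1r.
by rewrite -[LHS](subrK (hinge_interp m f (j%:R / m%:R))) step IHj ?subrK// ltnW.
Qed.

Lemma node_cell m x : (0 < m)%N -> 0 <= x <= 1 ->
  exists2 j, (j < m)%N & j%:R / m%:R <= x <= j.+1%:R / m%:R.
Proof.
move=> m0 /andP[x0 x1]; have mgt0 : 0 < m%:R :> R by rewrite ltr0n.
suff cell k : (k <= m)%N -> (0 < k)%N -> x <= k%:R / m%:R ->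
    exists2 j, (j < m)%N & j%:R / m%:R <= x <= j.+1%:R / m%:R.
  by apply: (cell m) => //; rewrite divff ?gt_eqF.
elim: k => [//|k IHk] km _ xk.
have [xlt|xge] := leP x (k%:R / m%:R); last by exists k => //; rewrite (ltW xge) xk.
have [k0|k0] := posnP k; last by apply: IHk => //; exact: ltnW.
by exists 0%N => //; rewrite mul0r x0 -[1%N]/(0.+1) -k0 xk.
Qed.

(** All corners are nodes, so none lies inside the cell that holds the three points, and every hinge
    is affine there. *)
Lemma second_difference_hinge_interp m f j x h : (0 < m)%N -> 0 <= h ->
  j%:R / m%:R <= x -> x + 2 * h <= j.+1%:R / m%:R ->
  hinge_interp m f (x + 2 * h) - 2 * hinge_interp m f (x + h) +
  hinge_interp m f x = 0.
Proof.
move=> m0 h0 jx xj; have mgt0 : 0 < m%:R :> R by rewrite ltr0n.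
have affine i : hinge (i%:R / m%:R) (x + 2 * h) =
    2 * hinge (i%:R / m%:R) (x + h) - hinge (i%:R / m%:R) x.
  have [ij|ji] := leqP i j.
    have : i%:R / m%:R <= j%:R / m%:R :> R by rewrite ler_pM2r ?invr_gt0// ler_nat.
    by move=> ?; rewrite !hinge_right; [ring|lra..].
  have : j.+1%:R / m%:R <= i%:R / m%:R :> R by rewrite ler_pM2r ?invr_gt0// ler_nat.
  by move=> ?; rewrite !hinge_left; [ring|lra..].
rewrite /hinge_interp; under eq_bigr do rewrite affine mulrBr mulrCA.
by rewrite sumrB -mulr_sumr; ring.
Qed.

(** On each cell the error vanishes at both ends and, the interpolant being affine, has the same
    second differences as [f]; hence [le_second_difference] applies. *)
Lemma hinge_interp_approx m f w : (0 < m)%N ->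
  {within `[0, 1], continuous f} ->
  (forall x h, 0 <= h <= m%:R^-1 -> 0 <= x -> x + 2 * h <= 1 ->
    `|f (x + 2 * h) - 2 * f (x + h) + f x| <= w) ->
  forall x, 0 <= x <= 1 -> `|f x - hinge_interp m f x| <= w.
Proof.
move=> m0 cf fw x x01; have mgt0 : 0 < m%:R :> R by rewrite ltr0n.
have [j jm xj] := node_cell m0 x01.
have j0 : 0 <= j%:R / m%:R :> R by rewrite divr_ge0.
have jS : j.+1%:R / m%:R = j%:R / m%:R + m%:R^-1 :> R.
  by rewrite -natr1 mulrDl mul1r.
have j1 : j.+1%:R / m%:R <= 1 :> R by rewrite ler_pdivrMr// mul1r ler_nat.
have minv : 0 < m%:R^-1 :> R by rewrite invr_gt0.
apply: (@le_second_difference (fun y => f y - hinge_interp m f y)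
  (j%:R / m%:R) (j.+1%:R / m%:R)) => //.
- by rewrite jS; lra.
- apply: (@continuous_subspaceW R R _ `[0, 1]).
    by apply: subset_itvScc; rewrite bnd_simp.
  move=> y; apply: cvgB; first exact: cf.
  exact: (continuous_subspaceT (@continuous_hinge_interp m f)).
- by rewrite hinge_interp_node ?subrr// ltnW.
- by rewrite hinge_interp_node ?subrr.
move=> y h h0 jy yj.
have := second_difference_hinge_interp f m0 h0 jy yj => s0.
rewrite (_ : _ + _ = f (y + 2 * h) - 2 * f (y + h) + f y -
  (hinge_interp m f (y + 2 * h) - 2 * hinge_interp m f (y + h) +
   hinge_interp m f y)); last by ring.
rewrite s0 subr0; apply: fw; lra.
Qed.
End HingeInterpolation.

(** * Comparison of positive means *)

Section PositiveMeans.
Variable R : realType.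
Implicit Types (f g : R -> R) (A B : (R -> R) -> R) (c w x h : R) (m : nat).

Local Notation continuous01 f := {within `[0 : R, 1], continuous f}.

(** A normalised positive linear functional on C[0,1]. The laws are restricted to continuous
    functions because these are bounded on [0,1], which makes the series of the limit operator
    converge. *)
Record positive_mean A : Prop := {
  mean_add f g : continuous01 f -> continuous01 g ->
    A (fun x => f x + g x) = A f + A g;
  mean_scale c f : continuous01 f -> A (fun x => c * f x) = c * A f;
  mean_le f g : continuous01 f -> continuous01 g ->
    (forall x, 0 <= x <= 1 -> f x <= g x) -> A f <= A g;
  mean_one : A (fun=> 1) = 1 }.

Lemma continuous01_add f g : continuous01 f -> continuous01 g ->
  continuous01 (fun x => f x + g x).
Proof. by move=> cf cg x; apply: cvgD; [exact: cf|exact: cg]. Qed.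

Lemma continuous01_scale c f : continuous01 f -> continuous01 (fun x => c * f x).
Proof. by move=> cf x; apply: cvgM; [exact: cvg_cst|exact: cf]. Qed.

Lemma continuous01_cst c : continuous01 (fun _ : R => c).
Proof. by apply: continuous_subspaceT => x; exact: cvg_cst. Qed.

Lemma continuous01_id : continuous01 (fun x : R => x).
Proof. by apply: continuous_subspaceT => x; exact: cvg_id. Qed.

Lemma continuous01_sqr : continuous01 (fun x : R => x ^+ 2).
Proof.
by apply: continuous_subspaceT => x; apply: cvgM; exact: cvg_id.
Qed.

Lemma continuous01_hinge c : continuous01 (hinge c).
Proof. by apply: continuous_subspaceT; exact: continuous_hinge. Qed.

Lemma continuous01_hinge_interp m f : continuous01 (hinge_interp m f).
Proof. by apply: continuous_subspaceT; exact: continuous_hinge_interp. Qed.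

Lemma mean_cst A c : positive_mean A -> A (fun=> c) = c.
Proof.
move=> mA; rewrite -[RHS]mulr1 -(mean_one mA) -(mean_scale mA); last exact: continuous01_cst.
by congr A; apply/funext => x; rewrite mulr1.
Qed.

Lemma mean_sum A I (r : seq I) (a : I -> R) (G : I -> R -> R) :
  positive_mean A -> (forall i, continuous01 (G i)) ->
  A (fun x => \sum_(i <- r) a i * G i x) = \sum_(i <- r) a i * A (G i).
Proof.
move=> mA cG; elim: r => [|i r IHr].
  by rewrite big_nil (_ : (fun _ => _) = fun=> 0) ?mean_cst//;
     apply/funext => x; rewrite big_nil.
rewrite big_cons -IHr -mean_scale// -mean_add//.
- by congr A; apply/funext => x; rewrite big_cons.
- exact: continuous01_scale.
move=> x; apply: cvg_big => [|j _]; first exact: add_continuous.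
exact: continuous01_scale.
Qed.

Lemma mean_hinge_interp A m f : positive_mean A ->
  A (hinge_interp m f) = f 0 + m%:R * (f m%:R^-1 - f 0) * A (fun x => x) +
    \sum_(1 <= i < m) m%:R * node_difference m f i * A (hinge (i%:R / m%:R)).
Proof.
move=> mA; rewrite -mean_sum//; last by move=> i; exact: continuous01_hinge.
have csum : continuous01 (fun x => \sum_(1 <= i < m) m%:R * node_difference m f i * hinge (i%:R / m%:R) x).
  move=> x; apply: cvg_big => [|j _]; first exact: add_continuous.
  by apply: continuous01_scale; exact: continuous01_hinge.
rewrite -{1}(mean_cst (f 0) mA) -mean_scale//; last exact: continuous01_id.
rewrite -!mean_add//.
- apply: continuous01_add; first exact: continuous01_cst.
  by apply: continuous01_scale; exact: continuous01_id.
- exact: continuous01_cst.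
- by apply: continuous01_scale; exact: continuous01_id.
Qed.

Lemma mean_dist A f g w : positive_mean A -> continuous01 f -> continuous01 g ->
  (forall x, 0 <= x <= 1 -> `|f x - g x| <= w) -> `|A f - A g| <= w.
Proof.
move=> mA cf cg fgw; have cw : continuous01 (fun _ : R => w) by exact: continuous01_cst.
rewrite ler_distl lerBlDr; rewrite -{1 2}(mean_cst w mA) -!mean_add//.
apply/andP; split; apply: mean_le => //; try exact: continuous01_add.
  by move=> x /fgw; rewrite ler_distl lerBlDr => /andP[].
by move=> x /fgw; rewrite ler_distl => /andP[].
Qed.

(** Passing to the interpolant costs [w] for each mean. On interpolants the difference of the means
    is a combination of the nonnegative numbers [A (hinge c) - B (hinge c)] with coefficients at
    most m w in absolute value. Their sum [D] is found by testing on the square: m D is at most m^2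
    lam / 2 + 2. This gives 2 w + 2 w + m^2 lam w / 2. *)
Theorem mean_difference A B m f w lam :
  positive_mean A -> positive_mean B -> (0 < m)%N ->
  A (fun x => x) = B (fun x => x) ->
  (forall c, B (hinge c) <= A (hinge c)) ->
  A (fun x => x ^+ 2) <= B (fun x => x ^+ 2) + lam ->
  continuous01 f ->
  (forall x h, 0 <= h <= m%:R^-1 -> 0 <= x -> x + 2 * h <= 1 ->
    `|f (x + 2 * h) - 2 * f (x + h) + f x| <= w) ->
  `|A f - B f| <= (4 + m%:R ^+ 2 * lam / 2) * w.
Proof.
move=> mA mB m0 ABid ABhinge ABsqr cf fw.
have mgt0 : 0 < m%:R :> R by rewrite ltr0n.
have minv : 0 < m%:R^-1 :> R by rewrite invr_gt0.
pose D := \sum_(1 <= i < m) (A (hinge (i%:R / m%:R)) - B (hinge (i%:R / m%:R))).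
have w0 : 0 <= w.
  have := fw 0 0; rewrite lexx (ltW minv) mulr0 addr0 ler01 => /(_ isT isT isT).
  exact: le_trans.
have near_interp E g v : positive_mean E -> continuous01 g ->
    (forall x h, 0 <= h <= m%:R^-1 -> 0 <= x -> x + 2 * h <= 1 ->
      `|g (x + 2 * h) - 2 * g (x + h) + g x| <= v) ->
    `|E g - E (hinge_interp m g)| <= v.
  move=> mE cg gv; apply: mean_dist => //; first exact: continuous01_hinge_interp.
  exact: hinge_interp_approx.
have sqr_w x h : 0 <= h <= m%:R^-1 -> 0 <= x -> x + 2 * h <= 1 ->
    `|(x + 2 * h) ^+ 2 - 2 * (x + h) ^+ 2 + x ^+ 2| <= 2 * m%:R^-1 ^+ 2.
  move=> /andP[h0 hm] _ _.
  rewrite (_ : _ + _ = 2 * h ^+ 2); last by ring.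
  rewrite ger0_norm ?mulr_ge0 ?sqr_ge0// ler_pM2l// ler_sqr// nnegrE ltW//.
have sqrA := near_interp A _ _ mA continuous01_sqr sqr_w.
have sqrB := near_interp B _ _ mB continuous01_sqr sqr_w.
(* All node differences of the square equal 2/m^2, so its interpolant sees exactly the plain sum
   [D]. *)
have DE : A (hinge_interp m (fun x => x ^+ 2)) -
    B (hinge_interp m (fun x => x ^+ 2)) = 2 * m%:R^-1 * D.
  rewrite !mean_hinge_interp// ABid opprD addrACA subrr add0r -sumrB mulr_sumr.
  apply: eq_big_nat => i /andP[i1 _]; rewrite -mulrBr; congr (_ * _).
  rewrite /node_difference -(prednK i1) /= -!natr1.
  by field; rewrite gt_eqF.
have fA := near_interp A _ _ mA cf fw.
have fB := near_interp B _ _ mB cf fw.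
have DfE : `|A (hinge_interp m f) - B (hinge_interp m f)| <= m%:R * w * D.
  rewrite !mean_hinge_interp// ABid opprD addrACA subrr add0r -sumrB mulr_sumr.
  rewrite big_nat [leRHS]big_nat; apply: le_trans (ler_norm_sum _ _ _) _.
  apply: ler_sum => i /andP[i1 im]; rewrite -mulrBr !normrM.
  rewrite (ger0_norm (ltW mgt0)) -!mulrA; apply: ler_wpM2l; first exact: ltW.
  rewrite (@ger0_norm _ (_ - _)) ?subr_ge0//; apply: ler_wpM2r; first by rewrite subr_ge0.
  have iE : i%:R = i.-1%:R + 1 :> R by rewrite natr1 prednK.
  (* A node difference is the second difference that starts at the previous node with the largest
     admissible step 1/m. *)
  have := fw (i.-1%:R / m%:R) m%:R^-1.
  rewrite ltW// lexx divr_ge0// /node_difference -[i.+1%:R]natr1 iE => /(_ isT isT).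
  rewrite (_ : _ / _ + 2 * _ = (i.-1%:R + 1 + 1) / m%:R); last by ring.
  rewrite (_ : _ / _ + m%:R^-1 = (i.-1%:R + 1) / m%:R); last by ring.
  by apply; rewrite -iE natr1 ler_pdivrMr// mul1r ler_nat.
have Dle : m%:R * D <= m%:R ^+ 2 * lam / 2 + 2.
  (* Interpolating the square costs 2/m^2 under each of the two means. *)
  have : 2 * m%:R^-1 * D <= lam + 4 * m%:R^-1 ^+ 2.
    rewrite -DE; move: sqrA sqrB; rewrite !ler_distl; lra.
  rewrite -(@ler_pM2l _ (m%:R ^+ 2 / 2)) ?divr_gt0 ?exprn_gt0//.
  rewrite (_ : _ * (2 * _ * _) = m%:R * D); last by field; rewrite gt_eqF.
  by rewrite (_ : _ * (_ + _) = m%:R ^+ 2 * lam / 2 + 2)//; field; rewrite gt_eqF.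
have := ler_wpM2r w0 Dle; rewrite mulrDl (mulrAC _ D) => {}Dle.
move: fA fB DfE Dle; rewrite !ler_distl [(4 + _) * w]mulrDl.
move: (A f) (B f) (A _) (B _) (_ / 2 * w) (m%:R * w * D) => a b a' b' l d.
lra.
Qed.
End PositiveMeans.

(** * The Lupas operators *)

Section QIntegers.
Variable R : realType.
Implicit Types (q x : R) (n k : nat).

Lemma qint0 q : qint q 0 = 0.
Proof. by rewrite /qint big_geq. Qed.

Lemma qint1 q : qint q 1 = 1.
Proof. by rewrite /qint big_nat1. Qed.

Lemma qintS q n : qint q n.+1 = qint q n + q ^+ n.
Proof. by rewrite /qint big_nat_recr. Qed.

Lemma qint_addn q m n : qint q (m + n) = qint q m + q ^+ m * qint q n.
Proof.
elim: n => [|n IHn]; first by rewrite addn0 qint0 mulr0 addr0.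
by rewrite addnS !qintS IHn exprD; ring.
Qed.

Lemma qintSl q n : qint q n.+1 = 1 + q * qint q n.
Proof. by rewrite -add1n qint_addn qint1 expr1. Qed.

Lemma qint_ge0 q n : 0 <= q -> 0 <= qint q n.
Proof. by move=> q0; apply: sumr_ge0 => i _; exact: exprn_ge0. Qed.

Lemma qint_ge1 q n : 0 <= q -> (0 < n)%N -> 1 <= qint q n.
Proof.
case: n => // n q0 _; rewrite qintSl lerDl mulr_ge0// qint_ge0//.
Qed.

Lemma qint_gt0 q n : 0 <= q -> (0 < n)%N -> 0 < qint q n.
Proof. by move=> q0 n0; apply: lt_le_trans (qint_ge1 q0 n0). Qed.

Lemma le_qint q k n : 0 <= q -> (k <= n)%N -> qint q k <= qint q n.
Proof.
move=> q0 kn; rewrite -(subnKC kn) qint_addn lerDl.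
by rewrite mulr_ge0 ?exprn_ge0// qint_ge0.
Qed.

Lemma qint_ratio01 q k n : 0 <= q -> (k <= n)%N -> (0 < n)%N ->
  0 <= qint q k / qint q n <= 1.
Proof.
move=> q0 kn n0; rewrite divr_ge0 ?qint_ge0//=.
by rewrite ler_pdivrMr ?qint_gt0// mul1r le_qint.
Qed.

Lemma qfact0 q : qfact q 0 = 1.
Proof. by rewrite /qfact big_geq. Qed.

Lemma qfactS q n : qfact q n.+1 = qfact q n * qint q n.+1.
Proof. by rewrite /qfact big_nat_recr. Qed.

Lemma qfact_gt0 q n : 0 <= q -> 0 < qfact q n.
Proof.
move=> q0; elim: n => [|n IHn]; first by rewrite qfact0.
by rewrite qfactS mulr_gt0// qint_gt0.
Qed.

Lemma qbinom_ge0 q n k : 0 <= q -> 0 <= qbinom q n k.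
Proof.
by move=> q0; rewrite /qbinom divr_ge0 ?mulr_ge0// ltW// qfact_gt0.
Qed.

Lemma qbinom_lower q n k : 0 <= q -> (k <= n)%N ->
  qbinom q n.+1 k * (qint q (n.+1 - k) / qint q n.+1) = qbinom q n k.
Proof.
move=> q0 kn; rewrite /qbinom subSn// !qfactS; field.
by rewrite !gt_eqF ?qint_gt0 ?qfact_gt0.
Qed.

Lemma qbinom_lowerS q n k : 0 <= q -> (k <= n)%N ->
  qbinom q n.+1 k.+1 * (qint q k.+1 / qint q n.+1) = qbinom q n k.
Proof.
move=> q0 kn; rewrite /qbinom subSS !qfactS; field.
by rewrite !gt_eqF ?qint_gt0 ?qfact_gt0.
Qed.

Lemma triangularS k :
  ((k.+1 * (k.+1 - 1))./2 = (k * (k - 1))./2 + k)%N.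
Proof. by rewrite !subn1 -!bin2 binS bin1 addnC. Qed.
End QIntegers.

(** * Degree raising and the moments of the Lupas operators *)

Section LupasOperator.
Variables (R : realType) (q x : R).
Hypotheses (q0 : 0 < q) (x01 : 0 <= x <= 1).
Implicit Types (f : R -> R) (n k : nat).

Let q_ge0 : 0 <= q := ltW q0.

Definition lupas_basis n k : R :=
  qbinom q n k * (q ^+ (k * (k - 1))./2 * x ^+ k * (1 - x) ^+ (n - k) /
    \prod_(1 <= j < n) (1 - x + q ^+ j * x)).

Lemma lupas_factor_gt0 j : 0 < 1 - x + q ^+ j * x.
Proof.
have qj := exprn_gt0 j q0.
have [->|xneq0] := eqVneq x 0; first by rewrite mulr0 subr0 addr0.
have xgt0 : 0 < x by rewrite lt0r xneq0; case/andP: x01.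
by have := mulr_gt0 qj xgt0; move/andP: x01; lra.
Qed.

Lemma lupas_denominator_gt0 n :
  0 < \prod_(1 <= j < n) (1 - x + q ^+ j * x).
Proof. by apply: prodr_gt0 => j _; exact: lupas_factor_gt0. Qed.

Lemma lupas_basis_ge0 n k : 0 <= lupas_basis n k.
Proof.
move/andP: x01 => [x0 x1].
rewrite /lupas_basis mulr_ge0 ?qbinom_ge0// divr_ge0 ?(ltW (lupas_denominator_gt0 _))//.
by rewrite !mulr_ge0// exprn_ge0// subr_ge0.
Qed.

(** The share of the mass at index [k] in degree n+1 that belongs to index k-1 in degree n; the rest
    belongs to index [k]. *)
Definition raise_weight n k : R := q ^+ (n.+1 - k) * qint q k / qint q n.+1.

Lemma raise_weightC n k : (k <= n.+1)%N ->
  qint q (n.+1 - k) / qint q n.+1 = 1 - raise_weight n k.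
Proof.
move=> kn; have := qint_addn q (n.+1 - k) k; rewrite subnK// => E.
apply: (mulIf (lt0r_neq0 (qint_gt0 q_ge0 (ltn0Sn n)))).
rewrite /raise_weight mulrBl !divfK ?gt_eqF ?qint_gt0// mul1r [X in X - _]E; ring.
Qed.

Lemma raise_weight01 n k : (k <= n.+1)%N -> 0 <= raise_weight n k <= 1.
Proof.
move=> kn; rewrite /raise_weight divr_ge0 ?mulr_ge0 ?exprn_ge0 ?qint_ge0//=.
by rewrite -subr_ge0 -raise_weightC// divr_ge0 ?qint_ge0.
Qed.

(** Multiply and divide by the new denominator factor (1 - x) + q^n x: its two summands give the two
    terms on the right. *)
Lemma lupas_basis_raise n k : (0 < n)%N -> (k <= n)%N ->
  lupas_basis n k = lupas_basis n.+1 k * (1 - raise_weight n k) +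
    lupas_basis n.+1 k.+1 * raise_weight n k.+1.
Proof.
move=> n0 kn; rewrite -raise_weightC ?leqW// /raise_weight /lupas_basis.
rewrite !big_nat_recr//= triangularS !subSS [X in _ = X + _]mulrAC qbinom_lower//.
rewrite [X in _ = _ + X](_ : _ = qbinom q n.+1 k.+1 * (qint q k.+1 / qint q n.+1) *
  (q ^+ (n - k) * (q ^+ ((k * (k - 1))./2 + k) * x ^+ k.+1 * (1 - x) ^+ (n - k) /
  (\prod_(1 <= i < n) (1 - x + q ^+ i * x) * (1 - x + q ^+ n * x))))); last by ring.
rewrite qbinom_lowerS// subSn// exprD -[in q ^+ n](subnK kn) exprD.
rewrite !exprS; field.
rewrite !gt_eqF ?lupas_denominator_gt0//.
by rewrite -exprD subnK// lupas_factor_gt0.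
Qed.

Lemma lupas_raise n f : (0 < n)%N ->
  lupas n q f x = \sum_(0 <= k < n.+2) lupas_basis n.+1 k *
    ((1 - raise_weight n k) * f (qint q k / qint q n) +
     raise_weight n k * f (qint q k.-1 / qint q n)).
Proof.
move=> n0; rewrite /lupas.
under [RHS]eq_bigr do rewrite mulrDr.
rewrite big_split [X in _ = X + _]big_nat_recr//= [X in _ = _ + X]big_nat_recl//=.
(* The boundary terms drop out: 1 - w vanishes at k = n+1, where [k]/[n] may leave [0,1], and w
   vanishes at k = 0, where [k.-1] is a default value. *)
rewrite -[1 - raise_weight n n.+1]raise_weightC// subnn qint0 !mul0r mulr0 addr0.
rewrite [X in _ = _ + (X + _)](_ : _ = 0); last first.
  by rewrite /raise_weight qint0 mulr0 !mul0r mulr0.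
rewrite add0r -big_split big_nat [RHS]big_nat; apply: eq_bigr => k /andP[_ kn].
rewrite /= -/(lupas_basis n k) lupas_basis_raise//; ring.
Qed.

(** Each new node is the mean of two old ones, so the first moment is kept and Jensen's inequality
    applies to convex functions. *)
Lemma raise_node n k : (0 < n)%N -> (k <= n.+1)%N ->
  (1 - raise_weight n k) * (qint q k / qint q n) +
  raise_weight n k * (qint q k.-1 / qint q n) = qint q k / qint q n.+1.
Proof.
move=> n0 kn; rewrite -raise_weightC// /raise_weight.
case: k kn => [|k] kn; first by rewrite qint0 !(mul0r,mulr0) addr0.
have := qint_addn q (n.+1 - k.+1) k; rewrite subSS subnK// => E.
have Nn := lt0r_neq0 (qint_gt0 q_ge0 n0).
have NS := lt0r_neq0 (qint_gt0 q_ge0 (ltn0Sn n)).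
apply: (mulIf (mulf_neq0 Nn NS)); rewrite [RHS](_ : _ = qint q k.+1 * qint q n).
  by rewrite E /=; field; rewrite -E Nn.
by field; rewrite NS.
Qed.

(** The excess is the variance w (1 - w) (q^(k-1) / [n])^2 of the two-point average. It is a
    multiple of t - t^2 at the new node t, with a factor free of [k], so the second moments satisfy
    a closed recursion. *)
Lemma raise_node_sqr n k : (0 < n)%N -> (k <= n.+1)%N ->
  (1 - raise_weight n k) * (qint q k / qint q n) ^+ 2 +
  raise_weight n k * (qint q k.-1 / qint q n) ^+ 2 =
  (qint q k / qint q n.+1) ^+ 2 + q ^+ n.-1 / qint q n ^+ 2 *
    (qint q k / qint q n.+1 - (qint q k / qint q n.+1) ^+ 2).
Proof.
move=> n0 kn; rewrite -raise_weightC// /raise_weight.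
case: k kn => [|k] kn; first by rewrite qint0; ring.
have Nn := lt0r_neq0 (qint_gt0 q_ge0 n0).
have NS := lt0r_neq0 (qint_gt0 q_ge0 (ltn0Sn n)).
have EM : qint q n = qint q (n - k) + q ^+ (n - k) * qint q k.
  by rewrite -qint_addn subnK.
have EN : qint q n.+1 = qint q (n - k) + q ^+ (n - k) * qint q k.+1.
  by rewrite -qint_addn addnS subnK.
have EN' : qint q n.+1 = qint q k.+1 + q * q ^+ k * qint q (n - k).
  by rewrite -exprS -qint_addn addSn subnKC.
have Eq : q ^+ n.-1 * q = q ^+ k * q ^+ (n - k).
  by rewrite -exprSr prednK// -exprD subnKC.
have Ea : qint q k.+1 = qint q k + q ^+ k by rewrite qintS.
rewrite subSS /=.
(* The q-integers and powers become variables tied only by the equations above, which leaves a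
   polynomial identity. *)
set M := qint q n in Nn EM *; set N := qint q n.+1 in NS EN EN' *.
set a := qint q k.+1 in EN EN' Ea *; set K := qint q k in EM Ea *.
set r := qint q (n - k) in EM EN EN' *.
clearbody M N a K r.
move: (q ^+ n.-1) (q ^+ k) (q ^+ (n - k)) Eq Ea EM EN EN' => S Q P Eq Ea EM EN EN'.
have key : (r * a ^+ 2 + P * a * K ^+ 2) * N = a ^+ 2 * M ^+ 2 + S * a * (N - a).
  have -> : S * a * (N - a) = a * Q * r * (S * q) by rewrite {1}EN'; ring.
  by rewrite Eq EN EM Ea; ring.
have -> : r / N * (a / M) ^+ 2 + P * a / N * (K / M) ^+ 2 =
    (r * a ^+ 2 + P * a * K ^+ 2) * N / (M ^+ 2 * N ^+ 2).
  by field; rewrite ?Nn ?NS.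
by rewrite key; field; rewrite ?Nn ?NS.
Qed.

(** Degree raising keeps the value of a constant, so degree 1 decides. *)
Lemma lupas_one n : (0 < n)%N -> lupas n q (fun=> 1) x = 1.
Proof.
elim: n => // -[_ _|n IHn _].
  rewrite /lupas big_nat_recr//= big_nat1 !big_geq//= /qbinom !qfactS !qfact0.
  rewrite ?qint0 qint1 /= subn0 subnn.
  by rewrite !(mul1r,mulr1,mul0r,mulr0,divr1,expr0,expr1,invr1,expr1n,expr0n,subrr,subr0,add0r) ?subrK.
rewrite -[RHS](IHn isT) [RHS]lupas_raise// /lupas; apply: eq_bigr => k _.
by rewrite /= !mulr1 subrK mulr1 mul1r.
Qed.

Lemma lupas_id n : (0 < n)%N -> lupas n q (fun y => y) x = x.
Proof.
elim: n => // -[_ _|n IHn _].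
  rewrite /lupas big_nat_recr//= big_nat1 !big_geq//= /qbinom !qfactS !qfact0.
  rewrite ?qint0 qint1 /= subn0 subnn.
  by rewrite !(mul1r,mulr1,mul0r,mulr0,divr1,expr0,expr1,invr1,expr1n,expr0n,subrr,subr0,add0r) ?subrK.
rewrite -[RHS](IHn isT) [RHS]lupas_raise// /lupas.
apply: eq_big_nat => k /andP[_ kn]; rewrite raise_node//.
by rewrite /lupas_basis; ring.
Qed.

Lemma lupas_positive_mean n : (0 < n)%N ->
  positive_mean (fun f => lupas n q f x).
Proof.
move=> n0; split.
- move=> f g _ _; rewrite /lupas -big_split; apply: eq_bigr => k _; exact: mulrDl.
- move=> c f _; rewrite /lupas mulr_sumr; apply: eq_bigr => k _.
  by rewrite -mulrA.
- move=> f g _ _ fg; apply: ler_sum_nat => k /andP[_ kn].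
  rewrite -/(lupas_basis n k) ler_wpM2r ?lupas_basis_ge0//.
  by apply: fg; exact: qint_ratio01.
- exact: lupas_one.
Qed.

Lemma lupas_sqr_rec n : (0 < n)%N ->
  lupas n q (fun y => y ^+ 2) x = lupas n.+1 q (fun y => y ^+ 2) x +
    q ^+ n.-1 / qint q n ^+ 2 * (x - lupas n.+1 q (fun y => y ^+ 2) x).
Proof.
move=> n0; rewrite lupas_raise// -[X in X - _](lupas_id (ltn0Sn n)) /lupas.
rewrite -sumrB mulr_sumr -big_split.
apply: eq_big_nat => k /andP[_ kn]; rewrite raise_node_sqr//=.
by rewrite /lupas_basis; ring.
Qed.

Lemma lupas_sqr n : (0 < n)%N ->
  lupas n q (fun y => y ^+ 2) x =
  x - (1 - (qint q n)^-1) * (x * (1 - x) / (1 - x + q * x)).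
Proof.
have D0 := lt0r_neq0 (lupas_factor_gt0 1); rewrite expr1 in D0.
have q1 : 1 + q != 0 by rewrite lt0r_neq0// addr_gt0.
elim: n => // -[_ _|].
  rewrite /lupas big_nat_recr//= big_nat1 !big_geq//= /qbinom !qfactS !qfact0.
  rewrite ?qint0 qint1 /= subn0 subnn.
  by rewrite !(mul1r,mulr1,mul0r,mulr0,divr1,expr0,expr1,invr1,expr1n,expr0n,subrr,subr0,add0r) ?subrK.
(* Degree 2 is computed directly: for n = 1 the recursion cannot be solved for the next moment,
   since [1]^2 - q^0 = 0. *)
case=> [_ _|n IHn _].
  rewrite /lupas big_nat_recr//= big_nat_recr//= !big_nat1 /qbinom !qfactS !qfact0.
  rewrite qintS qint1 qint0 /= !subn0 !subnn; field.
  by rewrite D0 q1.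
have := lupas_sqr_rec (ltn0Sn n.+1); rewrite IHn//=.
set S := lupas _ _ _ _; set V := _ / (1 - x + q * x).
have := qint_gt0 q_ge0 (ltn0Sn n); have := qint_gt0 q_ge0 (ltn0Sn n.+1).
have := qint_gt0 q_ge0 (ltn0Sn n.+2).
have := qintSl q n.+1; have := qintS q n.+1; have := qintSl q n.+2.
move: (qint q n.+1) (qint q n.+2) (qint q n.+3) (q ^+ n.+1) => a N N' Q.
move=> N'E NQ Nqa N'0 N0 a0 E.
have SE : (x - S) * (N ^+ 2 - Q) = N * (N - 1) * V.
  have -> : (x - S) * (N ^+ 2 - Q) =
      (x - (S + Q / N ^+ 2 * (x - S))) * N ^+ 2 by field; rewrite lt0r_neq0.
  by rewrite -E; field; rewrite lt0r_neq0.
(* Here [n+2]^2 - q^(n+1) = [n+1] [n+3], which is nonzero and can be cancelled. *)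
have xS : a * N' * (x - S) = a * N' * ((1 - N'^-1) * V).
  have -> : a * N' * (x - S) = (x - S) * (N ^+ 2 - Q).
    have -> : Q = N - a by rewrite NQ; ring.
    by rewrite N'E Nqa; ring.
  rewrite SE; have -> : a * N' * ((1 - N'^-1) * V) = a * (N' - 1) * V.
    by field; rewrite lt0r_neq0.
  by rewrite N'E Nqa; ring.
have /mulfI /(_ _ _ xS) <- : a * N' != 0 by rewrite lt0r_neq0// mulr_gt0.
by rewrite subKr.
Qed.

(** Jensen's inequality for the two-point average at each new node. *)
Lemma lupas_hinge_nincr n c : (0 < n)%N ->
  lupas n.+1 q (hinge c) x <= lupas n q (hinge c) x.
Proof.
move=> n0; rewrite [leRHS]lupas_raise//.
apply: ler_sum_nat => k /andP[_ kn]; rewrite -/(lupas_basis _ _) mulrC.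
apply: ler_wpM2l; first exact: lupas_basis_ge0.
rewrite -raise_node//; have /andP[w0 w1] := @raise_weight01 n k kn.
exact: hinge_convex.
Qed.

End LupasOperator.

(** * The limit operator *)

Section SeriesMean.
Variable R : realType.

Lemma continuous01_bounded (f : R -> R) : {within `[0, 1], continuous f} ->
  exists M, forall x, 0 <= x <= 1 -> `|f x| <= M.
Proof.
move=> cf; have cnf : {within `[0, 1], continuous (fun y => `|f y|)}.
  by move=> y; apply: cvg_norm; exact: cf.
have [c _ fmax] := EVT_max ler01 cnf.
by exists `|f c| => x x01; apply: fmax; rewrite in_itv.
Qed.

(** A continuous [f] is bounded on [0,1], so the series is dominated by a multiple of that of
    [b]. *)
Lemma series_mean (y b : R^nat) :
  (forall k, 0 <= y k <= 1) -> (forall k, 0 <= b k) -> series b @ \oo --> (1 : R) ->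
  positive_mean (fun f => limn (series (fun k => f (y k) * b k))).
Proof.
move=> y01 b0 b1; have cvg_mean (f : R -> R) : {within `[0, 1], continuous f} ->
    cvgn (series (fun k => f (y k) * b k)).
  move=> /continuous01_bounded[M fM]; apply: normed_cvg.
  apply: (@series_le_cvg _ _ (fun k => M * b k)) => [k||k|].
  - exact: normr_ge0.
  - by move=> k; apply: mulr_ge0 => //; apply: le_trans (fM _ (y01 k)).
  - by rewrite /= normrM (ger0_norm (b0 k)) ler_wpM2r// fM.
  - rewrite (_ : (fun k => M * b k) = M *: b)//.
    by apply: is_cvg_seriesZ; apply/cvg_ex; exists 1.
split.
- move=> f g cf cg; rewrite -lim_seriesD; [|exact: cvg_mean..].
  by congr (limn (series _)); apply/funext => k; exact: mulrDl.
- move=> c f cf; have := lim_seriesZ c (cvg_mean f cf).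
  rewrite /GRing.scale /= => <-.
  by congr (limn (series _)); apply/funext => k; rewrite -mulrA.
- move=> f g cf cg fg; apply: lim_series_le; [exact: cvg_mean..|].
  by move=> k; apply: ler_wpM2r => //; exact: fg.
- rewrite (_ : (fun k => 1 * b k) = b); last by apply/funext => k; rewrite mul1r.
  exact: cvg_lim.
Qed.
End SeriesMean.

(** * The infinite product and the limit basis functions *)

Section LimitBasis.
Variables (R : realType) (q : R).
Hypotheses (q0 : 0 < q) (q1 : q < 1).
Implicit Types (u x : R) (n k m N K : nat).

Let q_ge0 : 0 <= q := ltW q0.

Lemma qint_closed n : (1 - q) * qint q n = 1 - q ^+ n.
Proof.
elim: n => [|n IHn]; first by rewrite qint0 mulr0 subrr.
by rewrite qintS mulrDr IHn exprS; ring.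
Qed.

(** The q-Pochhammer symbol (-u; q)_m. *)
Definition qpoch m u : R := \prod_(0 <= j < m) (1 + q ^+ j * u).

Definition qpoch_inf u : R := limn (qpoch^~ u).

Lemma qpoch_ge1 m u : 0 <= u -> 1 <= qpoch m u.
Proof.
move=> u0; rewrite /qpoch; elim/big_ind : _ => //.
- by move=> a b a1 b1; exact: mulr_ege1.
- by move=> j _; rewrite lerDl mulr_ge0// exprn_ge0.
Qed.

Lemma qpoch_addn N m u : qpoch (N + m) u = qpoch N u * qpoch m (q ^+ N * u).
Proof.
rewrite /qpoch (big_cat_nat (n := N)) ?leq_addr//=; congr (_ * _).
rewrite -{1}[N]add0n big_addn addKn; apply: eq_bigr => j _.
by rewrite exprD mulrA.
Qed.

Lemma qpoch_nondecreasing u : 0 <= u -> nondecreasing_seq (qpoch^~ u).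
Proof.
move=> u0 m N mN; rewrite -(subnKC mN) qpoch_addn ler_peMr//.
  by apply: le_trans (qpoch_ge1 m u0).
by apply: qpoch_ge1; rewrite mulr_ge0// exprn_ge0.
Qed.

(** From 1 + y <= exp y in each factor and [m] <= 1 / (1 - q); this bounds the increasing partial
    products. *)
Lemma qpoch_le_expR m u : 0 <= u -> qpoch m u <= expR (u / (1 - q)).
Proof.
move=> u0; have q1' : 0 < 1 - q by rewrite subr_gt0.
apply: (@le_trans _ _ (expR (u * qint q m))).
  elim: m => [|m IHm]; first by rewrite /qpoch big_geq// qint0 mulr0 expR0.
  rewrite /qpoch big_nat_recr//= qintS [u * _]mulrDr expRD ler_pM//.
  - by apply: prodr_ge0 => j _; rewrite addr_ge0// mulr_ge0// exprn_ge0.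
  - by rewrite addr_ge0// mulr_ge0// exprn_ge0.
  - by rewrite mulrC; exact: expR_ge1Dx.
rewrite ler_expR ler_wpM2l// -(@ler_pM2l _ (1 - q))// qint_closed divff ?lt0r_neq0//.
by rewrite gerBl exprn_ge0.
Qed.

Lemma cvg_qpoch u : 0 <= u -> qpoch^~ u @ \oo --> qpoch_inf u.
Proof.
move=> u0; apply: nondecreasing_is_cvgn; first exact: qpoch_nondecreasing.
by exists (expR (u / (1 - q))) => _ [m _ <-]; exact: qpoch_le_expR.
Qed.

Lemma qpoch_inf_ge1 u : 0 <= u -> 1 <= qpoch_inf u.
Proof.
move=> u0; apply: limr_ge; first exact: cvgP (cvg_qpoch u0).
by apply: nearW => m; exact: qpoch_ge1.
Qed.

Lemma qpoch_inf_split N u : 0 <= u ->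
  qpoch_inf u = qpoch N u * qpoch_inf (q ^+ N * u).
Proof.
move=> u0; have qu0 : 0 <= q ^+ N * u by rewrite mulr_ge0// exprn_ge0.
have := cvg_qpoch u0; rewrite -(cvg_shiftn N).
under eq_fun do rewrite addnC qpoch_addn.
move=> l1; apply: cvg_unique l1 _ => //.
by apply: cvgM; [exact: cvg_cst|exact: cvg_qpoch].
Qed.

(** The variable u = x / (1 - x) makes the scaling of u by q available. *)
Definition limit_basis k u : R :=
  q ^+ (k * (k - 1))./2 * u ^+ k / ((1 - q) ^+ k * qfact q k * qpoch_inf u).

Lemma limit_lupas_basisE k x :
  limit_lupas_basis q k x = limit_basis k (x / (1 - x)).
Proof. by []. Qed.

Lemma limit_basis_ge0 k u : 0 <= u -> 0 <= limit_basis k u.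
Proof.
move=> u0; rewrite divr_ge0 ?mulr_ge0 ?exprn_ge0// ?subr_ge0 ?ltW ?qfact_gt0//.
exact: lt_le_trans (qpoch_inf_ge1 u0).
Qed.

(* This is Euler's recursion [F u = (1 + u) F (q u)] for
   [F u = \sum_k q^(k(k-1)/2) u^k / ((1 - q)^k [k]!)], truncated at [K]. *)
Lemma sum_limit_basis_scale K u : 0 <= u ->
  \sum_(0 <= k < K) limit_basis k (q * u) =
  \sum_(0 <= k < K) limit_basis k u + limit_basis K u * (1 - q ^+ K).
Proof.
move=> u0; elim: K => [|K IHK]; first by rewrite !big_geq// expr0 subrr mulr0 addr0.
rewrite !big_nat_recr//= IHK -!addrA; congr (_ + _).
have P1 : qpoch_inf u = (1 + u) * qpoch_inf (q * u).
  by rewrite (qpoch_inf_split 1 u0) /qpoch big_nat1 expr0 mul1r expr1.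
have qu0 : 0 <= q * u by rewrite mulr_ge0.
have := qpoch_inf_ge1 qu0; rewrite /limit_basis P1 triangularS qfactS.
move: (qpoch_inf _) => P hP.
rewrite -(qint_closed K.+1).
rewrite exprMn exprD !exprS; field.
have q1' : 0 < 1 - q by rewrite subr_gt0.
rewrite !lt0r_neq0 ?qint_gt0 ?qfact_gt0 ?exprn_gt0//; last by lra.
by rewrite ltr_pwDl.
Qed.

Lemma cvg_qint : qint q N @[N --> \oo] --> (1 - q)^-1.
Proof.
have q1' : 1 - q != 0 by rewrite subr_eq0 gt_eqF.
have -> : (fun N => qint q N) = (fun N => (1 - q ^+ N) * (1 - q)^-1).
  by apply/funext => N; rewrite -qint_closed mulrAC divff// mul1r.
suff : (1 - q ^+ N) * (1 - q)^-1 @[N --> \oo] --> (1 - 0) * (1 - q)^-1.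
  by rewrite subr0 mul1r.
apply: cvgM; last exact: cvg_cst.
apply: cvgB; first exact: cvg_cst.
by apply: cvg_expr; rewrite ger0_norm.
Qed.

Lemma cvg_node k : qint q k / qint q N @[N --> \oo] --> 1 - q ^+ k.
Proof.
have q1' : 1 - q != 0 by rewrite subr_eq0 gt_eqF.
rewrite -qint_closed mulrC -[1 - q]invrK.
apply: cvgM; first exact: cvg_cst.
by apply: cvgV; [rewrite invr_eq0|exact: cvg_qint].
Qed.

(** Induction on [k]: raising both indices multiplies the binomial by [N+1] / [k+1], and [N+1] tends
    to 1 / (1 - q). *)
Lemma cvg_qbinom k :
  qbinom q N k @[N --> \oo] --> ((1 - q) ^+ k * qfact q k)^-1.
Proof.
elim: k => [|k IHk].
  rewrite expr0 qfact0 mulr1 invr1.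
  have -> : (fun N => qbinom q N 0) = fun=> 1.
    apply/funext => N; rewrite /qbinom qfact0 subn0 mul1r divff//.
    by rewrite lt0r_neq0// qfact_gt0.
  exact: cvg_cst.
rewrite -(cvg_shiftS (fun N => qbinom q N k.+1)).
have -> : ((1 - q) ^+ k.+1 * qfact q k.+1)^-1 =
    ((1 - q) ^+ k * qfact q k)^-1 * ((1 - q)^-1 * (qint q k.+1)^-1).
  by rewrite exprS qfactS -!invfM; congr (_^-1); ring.
have lim : qbinom q N k * (qint q N.+1 * (qint q k.+1)^-1) @[N --> \oo] -->
    ((1 - q) ^+ k * qfact q k)^-1 * ((1 - q)^-1 * (qint q k.+1)^-1).
  apply: cvgM => //; apply: cvgM; last exact: cvg_cst.
  by rewrite (cvg_shiftS (fun N => qint q N)); exact: cvg_qint.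
apply: cvg_trans lim; apply: near_eq_cvg; near=> N.
rewrite -(@qbinom_lowerS _ q N k q_ge0); last by near: N; exact: nbhs_infty_ge.
by rewrite /=; field; rewrite !lt0r_neq0// qint_gt0.
Unshelve. all: by end_near. Qed.

Lemma lupas_basis_qpoch x N k : 0 <= x < 1 -> (k <= N)%N -> (0 < N)%N ->
  lupas_basis q x N k =
  qbinom q N k * (q ^+ (k * (k - 1))./2 * (x / (1 - x)) ^+ k / qpoch N (x / (1 - x))).
Proof.
move=> /andP[x0 x1] kN N0.
have u0 : 0 <= x / (1 - x) by rewrite divr_ge0// subr_ge0 ltW.
have x1' : 1 - x != 0 by rewrite subr_eq0 gt_eqF.
have PE : \prod_(1 <= j < N) (1 - x + q ^+ j * x) =
    (1 - x) ^+ N * qpoch N (x / (1 - x)).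
  rewrite /qpoch -[in (1 - x) ^+ N](subn0 N) -prodr_const_nat -big_split /=.
  rewrite [RHS]big_ltn//= expr0 mul1r.
  (* [qpoch] starts at j = 0 and the Lupas denominator at j = 1; the extra factor is (1 - x) (1 + x
     / (1 - x)) = 1. *)
  rewrite [X in _ = X * _](_ : _ = 1) ?mul1r; last by field.
  by apply: eq_bigr => j _; field.
rewrite /lupas_basis PE.
have -> : (1 - x) ^+ N = (1 - x) ^+ (N - k) * (1 - x) ^+ k by rewrite -exprD subnK.
rewrite expr_div_n; congr (_ * _); field.
by rewrite !expf_neq0// lt0r_neq0// (lt_le_trans _ (qpoch_ge1 _ u0)).
Qed.

Lemma cvg_lupas_basis x k : 0 <= x < 1 ->
  lupas_basis q x N k @[N --> \oo] --> limit_lupas_basis q k x.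
Proof.
move=> /andP[x0 x1]; have u0 : 0 <= x / (1 - x) by rewrite divr_ge0// subr_ge0 ltW.
have lim : qbinom q N k * (q ^+ (k * (k - 1))./2 * (x / (1 - x)) ^+ k / qpoch N (x / (1 - x)))
    @[N --> \oo] --> limit_lupas_basis q k x.
  rewrite limit_lupas_basisE /limit_basis invfM mulrCA.
  apply: cvgM; first exact: cvg_qbinom.
  apply: cvgM; first exact: cvg_cst.
  apply: cvgV; last exact: cvg_qpoch.
  by rewrite lt0r_neq0// (lt_le_trans _ (qpoch_inf_ge1 u0)).
apply: cvg_trans lim; apply: near_eq_cvg; near=> N.
rewrite lupas_basis_qpoch ?x0//; first by near: N; exact: nbhs_infty_ge.
by near: N; exact: nbhs_infty_gt.
Unshelve. all: by end_near. Qed.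

(* A Fatou lemma: only finite sums converge termwise, so [phi] must be nonnegative. *)
Lemma sum_limit_le x (phi : R -> R) C n K : 0 <= x < 1 -> continuous phi ->
  (forall y, 0 <= y <= 1 -> 0 <= phi y) ->
  (forall N, (n <= N)%N -> lupas N q phi x <= C) ->
  \sum_(0 <= k < K) phi (1 - q ^+ k) * limit_lupas_basis q k x <= C.
Proof.
move=> x01 cphi phi0 phiC.
have lim : \sum_(0 <= k < K) phi (qint q k / qint q N) * lupas_basis q x N k
    @[N --> \oo] --> \sum_(0 <= k < K) phi (1 - q ^+ k) * limit_lupas_basis q k x.
  apply: cvg_big => [|k _]; first exact: add_continuous.
  apply: cvgM; last exact: cvg_lupas_basis.
  by apply: continuous_cvg; [exact: cphi|exact: cvg_node].
rewrite -(cvg_lim _ lim)//; apply: limr_le; first exact: cvgP lim.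
near=> N.
apply: le_trans (phiC N _); last by near: N; exact: nbhs_infty_ge.
have KN : (K <= N.+1)%N by apply: leqW; near: N; exact: nbhs_infty_ge.
have N0 : (0 < N)%N by near: N; exact: nbhs_infty_gt.
rewrite /lupas [leRHS](big_cat_nat (n := K))//= lerDl.
rewrite big_nat; apply: sumr_ge0 => k /andP[_ kN]; apply: mulr_ge0.
  by apply: phi0; exact: qint_ratio01.
by apply: lupas_basis_ge0 => //; case/andP: x01 => -> /ltW.
Unshelve. all: by end_near. Qed.

(** Take phi = 1 in [sum_limit_le], at the point u / (1 + u) that corresponds to [u]. *)
Lemma sum_limit_basis_le1 K u : 0 <= u -> \sum_(0 <= k < K) limit_basis k u <= 1.
Proof.
move=> u0; have u1 : 0 < 1 + u by rewrite ltr_pwDl.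
have x01 : 0 <= u / (1 + u) < 1.
  by rewrite divr_ge0 ?(ltW u1)//= ltr_pdivrMr// mul1r ltrDr.
have uE : u / (1 + u) / (1 - u / (1 + u)) = u by field; rewrite lt0r_neq0//; lra.
have := @sum_limit_le (u / (1 + u)) (fun=> 1) 1 1 K x01.
under eq_bigr do rewrite mul1r limit_lupas_basisE uE.
apply=> // [y|N N0]; first exact: cvg_cst.
by rewrite lupas_one//; case/andP: x01 => -> /ltW.
Qed.

Lemma is_cvg_limit_basis u : 0 <= u -> cvgn (series (limit_basis^~ u)).
Proof.
move=> u0; apply: nondecreasing_is_cvgn.
  by apply: nondecreasing_series => k _ _; exact: limit_basis_ge0.
by exists 1 => _ [K _ <-]; exact: sum_limit_basis_le1.
Qed.

(* The sum [S u] satisfies [S (q u) = S u] and [S (q^N u)] is at least its zeroth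
   term [1 / qpoch_inf (q^N u)], which tends to 1. *)
Lemma limit_basis_sum1 u : 0 <= u -> series (limit_basis^~ u) @ \oo --> (1 : R).
Proof.
pose S u := limn (series (limit_basis^~ u)).
have cvgS v : 0 <= v -> series (limit_basis^~ v) @ \oo --> S v.
  exact: is_cvg_limit_basis.
have S_scale v : 0 <= v -> S (q * v) = S v.
  move=> v0; have qv0 : 0 <= q * v by rewrite mulr_ge0.
  apply: cvg_unique (cvgS _ qv0) _ => //.
  have -> : series (limit_basis^~ (q * v)) =
      fun K => series (limit_basis^~ v) K + limit_basis K v * (1 - q ^+ K).
    by apply/funext => K; exact: sum_limit_basis_scale.
  suff : series (limit_basis^~ v) K + limit_basis K v * (1 - q ^+ K) @[K --> \oo]
      --> S v + 0 * (1 - 0) by rewrite mul0r addr0.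
  apply: cvgD; first exact: cvgS.
  apply: cvgM; first exact: cvg_series_cvg_0 (is_cvg_limit_basis v0).
  apply: cvgB; first exact: cvg_cst.
  by apply: cvg_expr; rewrite ger0_norm.
have S_scaleN v N : 0 <= v -> S (q ^+ N * v) = S v.
  move=> v0; elim: N => [|N IHN]; first by rewrite expr0 mul1r.
  by rewrite exprS -mulrA S_scale// mulr_ge0// exprn_ge0.
move=> u0; suff -> : 1 = S u by exact: cvgS.
have Pu1 := qpoch_inf_ge1 u0.
have Pu0 : qpoch_inf u != 0 by rewrite lt0r_neq0// (lt_le_trans _ Pu1).
apply/le_anti/andP; split; last first.
  apply: limr_le; first exact: is_cvg_limit_basis.
  by apply: nearW => K; exact: sum_limit_basis_le1.
have lim : qpoch N u / qpoch_inf u @[N --> \oo] --> (1 : R).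
  suff : qpoch N u / qpoch_inf u @[N --> \oo] --> qpoch_inf u / qpoch_inf u.
    by rewrite divff.
  by apply: cvgM; [exact: cvg_qpoch|exact: cvg_cst].
rewrite -(cvg_lim _ lim)//; apply: limr_le; first exact: cvgP lim.
apply: nearW => N; rewrite -(S_scaleN _ N u0).
have v0 : 0 <= q ^+ N * u by rewrite mulr_ge0// exprn_ge0.
have := nondecreasing_cvgn_le _ (is_cvg_limit_basis v0) 1%N.
rewrite -/(S _) /series /= big_nat1 => S1; apply: le_trans (S1 _).
  rewrite /limit_basis expr0 mul0n !expr0 qfact0 !mul1r (qpoch_inf_split N u0) invfM.
  rewrite mulrA divff ?mul1r// lt0r_neq0// (lt_le_trans _ (qpoch_ge1 N u0))//.
by apply: nondecreasing_series => k _ _; exact: limit_basis_ge0.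
Qed.

End LimitBasis.

Section PointMean.
Variable R : realType.

(** Evaluation is the limit operator at x = 1 and, for q = 1, at every point. *)
Lemma point_mean (x : R) : 0 <= x <= 1 -> positive_mean (fun f => f x).
Proof. by move=> x01; split=> // f g _ _; exact. Qed.

Lemma le_mean_hinge (A : (R -> R) -> R) (x c : R) : positive_mean A ->
  A (fun y => y) = x -> hinge c x <= A (hinge c).
Proof.
move=> mA Ax; rewrite {1}/hinge ge_max; apply/andP; split.
  rewrite -{1}(mean_cst 0 mA); apply: (mean_le mA).
  - exact: continuous01_cst.
  - exact: continuous01_hinge.
  - by move=> y _; exact: hinge_ge0.
rewrite -Ax -(mean_cst (- c) mA) -(mean_add mA).
- apply: (mean_le mA).
  + by apply: continuous01_add; [exact: continuous01_id|exact: continuous01_cst].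
  + exact: continuous01_hinge.
  + by move=> y _; rewrite /hinge le_max lexx orbT.
- exact: continuous01_id.
- exact: continuous01_cst.
Qed.

(** The Fatou argument yields only upper bounds; applied to 1 - f it yields lower bounds for [f]. *)
Lemma mean_one_minus (A : (R -> R) -> R) (f : R -> R) : positive_mean A ->
  {within `[0, 1], continuous f} -> A (fun y => 1 - f y) = 1 - A f.
Proof.
move=> mA cf; have -> : (fun y => 1 - f y) = (fun y => 1 + -1 * f y).
  by apply/funext => y; rewrite mulN1r.
rewrite (mean_add mA) ?(mean_one mA) ?(mean_scale mA) ?mulN1r//.
  exact: continuous01_cst.
exact: continuous01_scale.
Qed.
End PointMean.

(** * Moments and hinges under the limit operator *)

Section LimitOperator.
Variables (R : realType) (q x : R).
Hypotheses (q0 : 0 < q) (q1 : q < 1) (x01 : 0 <= x <= 1).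

Let q_ge0 : 0 <= q := ltW q0.

Lemma limit_node01 k : 0 <= 1 - q ^+ k <= 1.
Proof.
have qk0 : 0 <= q ^+ k := exprn_ge0 k q_ge0.
have qk1 : q ^+ k <= 1 by apply: exprn_ile1 => //; exact: ltW.
by apply/andP; split; lra.
Qed.

Lemma le_qint_inv n : (0 < n)%N -> 1 - q <= (qint q n)^-1.
Proof.
move=> n0; rewrite -(@ler_pM2r _ (qint q n)) ?qint_gt0//.
rewrite qint_closed// mulVf ?lt0r_neq0 ?qint_gt0//.
by rewrite gerBl exprn_ge0.
Qed.

Lemma limit_lupas_lt1_mean : positive_mean (fun f => limit_lupas_lt1 q f x).
Proof.
have [->|xneq1] := eqVneq x 1.
  rewrite (_ : (fun _ => _) = fun f => f 1); last first.
    by apply/funext => f; rewrite /limit_lupas_lt1 eqxx.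
  by apply: point_mean; rewrite ler01 lexx.
rewrite (_ : (fun _ => _) = fun f : R -> R =>
    limn (series (fun k => f (1 - q ^+ k) * limit_lupas_basis q k x))); last first.
  by apply/funext => f; rewrite /limit_lupas_lt1 (negbTE xneq1).
move/andP: x01 => [x0 x1].
have u0 : 0 <= x / (1 - x) by rewrite divr_ge0// subr_ge0.
apply: (series_mean (y := fun k => 1 - q ^+ k)) => [k|k|].
- exact: limit_node01.
- by rewrite limit_lupas_basisE; exact: limit_basis_ge0.
- exact: limit_basis_sum1.
Qed.

Lemma limit_lupas_lt1_le (phi : R -> R) C n : x != 1 -> continuous phi ->
  (forall y, 0 <= y <= 1 -> 0 <= phi y) ->
  (forall N, (n <= N)%N -> lupas N q phi x <= C) ->
  limit_lupas_lt1 q phi x <= C.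
Proof.
move=> xneq1 cphi phi0 phiC; move/andP: x01 => [x0 x1].
have xlt1 : 0 <= x < 1 by rewrite x0 lt_neqAle xneq1.
have u0 : 0 <= x / (1 - x) by rewrite divr_ge0// subr_ge0.
have sumC K : \sum_(0 <= k < K) phi (1 - q ^+ k) * limit_lupas_basis q k x <= C.
  exact: (sum_limit_le q0 q1 _ xlt1 cphi phi0 phiC).
rewrite /limit_lupas_lt1 (negbTE xneq1); apply: limr_le.
  apply: nondecreasing_is_cvgn; last by exists C => _ [K _ <-]; exact: sumC.
  apply: nondecreasing_series => k _ _; apply: mulr_ge0.
    by apply: phi0; exact: limit_node01.
  by rewrite limit_lupas_basisE; exact: limit_basis_ge0.
by apply: nearW => K; exact: sumC.
Qed.

(** The Fatou bound for y gives one inequality, the one for 1 - y the other. *)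
Lemma limit_lupas_lt1_id : limit_lupas_lt1 q (fun y => y) x = x.
Proof.
have [x1|xneq1] := eqVneq x 1; first by rewrite /limit_lupas_lt1 x1 eqxx.
have cid : {within `[0, 1], continuous (fun y : R => y)} := @continuous01_id R.
apply/le_anti/andP; split.
  apply: (@limit_lupas_lt1_le _ _ 1) => // [y|y /andP[]//|N N0].
    exact: cvg_id.
  by rewrite lupas_id.
rewrite -lerN2 -(lerD2l 1) -(mean_one_minus limit_lupas_lt1_mean cid).
apply: (@limit_lupas_lt1_le _ _ 1) => // [y|y /andP[]|N N0].
- by apply: cvgB; [exact: cvg_cst|exact: cvg_id].
- by rewrite subr_ge0.
- by rewrite (mean_one_minus (lupas_positive_mean q0 x01 N0))// lupas_id.
Qed.

Lemma limit_lupas_lt1_hinge n c : (0 < n)%N ->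
  limit_lupas_lt1 q (hinge c) x <= lupas n q (hinge c) x.
Proof.
move=> n0; have [x1|xneq1] := eqVneq x 1.
  have := le_mean_hinge c (lupas_positive_mean q0 x01 n0) (lupas_id q0 x01 n0).
  by rewrite /limit_lupas_lt1 x1 eqxx.
apply: (@limit_lupas_lt1_le _ _ n) => // [y|y _|N].
- exact: continuous_hinge.
- exact: hinge_ge0.
elim: N => [|N IHN]; first by rewrite leqn0 => /eqP <-.
rewrite leq_eqVlt => /predU1P[<-//|nN].
by apply: le_trans (IHN nN); apply: lupas_hinge_nincr => //; exact: leq_trans n0 nN.
Qed.

Lemma lupas_variance01 : 0 <= x * (1 - x) / (1 - x + q * x) <= 1.
Proof.
have := lupas_factor_gt0 q0 x01 1; rewrite expr1 => D0.
move/andP: x01 => [x0 x1]; have x1' : 0 <= 1 - x by rewrite subr_ge0.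
rewrite divr_ge0 ?(mulr_ge0 x0 x1') ?(ltW D0)//= ler_pdivrMr// mul1r.
have : 0 <= q * x by rewrite mulr_ge0.
have : x * (1 - x) <= 1 - x by rewrite ler_piMl.
lra.
Qed.

(** The Fatou bound for 1 - y^2 shows that the limit moment is at least x - q V. The moment of
    degree n is x - (1 - 1/[n]) V, so the gap is at most (1/[n] - (1 - q)) V = (q^n / [n]) V, and V
    <= 1. *)
Lemma lupas_sqr_limit n : (0 < n)%N ->
  lupas n q (fun y => y ^+ 2) x <=
  limit_lupas_lt1 q (fun y => y ^+ 2) x + q ^+ n / qint q n.
Proof.
move=> n0; have csqr : {within `[0, 1], continuous (fun y : R => y ^+ 2)} := @continuous01_sqr R.
have nq0 := qint_gt0 q_ge0 n0.
have [x1|xneq1] := eqVneq x 1.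
  rewrite /limit_lupas_lt1 lupas_sqr// x1 eqxx subrr mulr0 mul0r mulr0 subr0 expr1n.
  by rewrite lerDl divr_ge0 ?exprn_ge0// ltW.
have /andP[V0 V1] := lupas_variance01.
set V := _ / _ in V0 V1.
have : limit_lupas_lt1 q (fun y => 1 - y ^+ 2) x <= 1 - x + q * V.
  apply: (@limit_lupas_lt1_le _ _ 1) => // [y|y /andP[y0 y1]|N N0].
  - by apply: cvgB; [exact: cvg_cst|apply: cvgM; exact: cvg_id].
  - by rewrite subr_ge0 exprn_ile1.
  rewrite (mean_one_minus (lupas_positive_mean q0 x01 N0))// lupas_sqr// -/V.
  rewrite opprB addrCA addrC lerD2l ler_wpM2r//.
  by have := le_qint_inv N0; lra.
rewrite (mean_one_minus limit_lupas_lt1_mean)// lupas_sqr// -/V.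
have -> : q ^+ n / qint q n = (qint q n)^-1 - (1 - q).
  have -> : q ^+ n = 1 - (1 - q) * qint q n by rewrite qint_closed; ring.
  by field; rewrite lt0r_neq0.
have W : 0 <= (qint q n)^-1 - (1 - q) by rewrite subr_ge0 le_qint_inv.
have := ler_piMr W V1.
lra.
Qed.

End LimitOperator.

(** * Reflection and the error bound *)

Section Reflection.
Variables (R : realType) (q : R).
Hypothesis q0 : 0 < q.
Implicit Types (f : R -> R) (x : R) (n k : nat).

Let p0 : 0 < q^-1. Proof. by rewrite invr_gt0. Qed.
Let qX0 n : q ^+ n != 0. Proof. by rewrite lt0r_neq0// exprn_gt0. Qed.

Lemma qint_inv n : q ^+ n * qint q^-1 n.+1 = qint q n.+1.
Proof.
elim: n => [|n IHn]; first by rewrite !qint1 mulr1.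
rewrite qintS mulrDr exprVn divff ?qX0//.
by rewrite exprS -mulrA IHn [RHS]qintSl addrC.
Qed.

Lemma qfact_inv n : q ^+ (n * (n - 1))./2 * qfact q^-1 n = qfact q n.
Proof.
elim: n => [|n IHn]; first by rewrite !qfact0 mulr1.
by rewrite triangularS !qfactS exprD -IHn -qint_inv; ring.
Qed.

Lemma lupas_denominator_inv x n :
  q ^+ (n * (n - 1))./2 * \prod_(1 <= j < n) (1 - (1 - x) + q^-1 ^+ j * (1 - x)) =
  \prod_(1 <= j < n) (1 - x + q ^+ j * x).
Proof.
elim: n => [|[|n] IHn]; [by rewrite !big_geq// mulr1..|].
rewrite triangularS exprD big_nat_recr//= [RHS]big_nat_recr//= -IHn mulrACA.
congr (_ * _); rewrite exprVn; field; exact: qX0.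
Qed.

Lemma lupas_node_inv n k : (k <= n)%N -> (0 < n)%N ->
  1 - qint q^-1 (n - k) / qint q^-1 n = qint q k / qint q n.
Proof.
(* The case k = n is separate because [qint_inv] is applied below at index (n - k) - 1. *)
move=> kn n0; have [kn'|] := ltnP k n; last first.
  move=> nk; have -> : k = n by apply/eqP; rewrite eqn_leq kn.
  by rewrite subnn qint0 mul0r subr0 divff// lt0r_neq0// qint_gt0// ltW.
have nq := lt0r_neq0 (qint_gt0 (ltW p0) n0).
have E := qint_addn q k (n - k); rewrite subnKC// in E.
have := qint_inv (n - k).-1; rewrite prednK ?subn_gt0// => Enk.
have := qint_inv n.-1; rewrite prednK// => En.
have -> : qint q k = qint q n - q ^+ k * qint q (n - k) by rewrite E; ring.
rewrite -Enk -En.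
have -> : q ^+ n.-1 = q ^+ k * q ^+ (n - k).-1.
  by rewrite -exprD; congr (_ ^+ _); lia.
by field; rewrite nq !qX0.
Qed.

Lemma lupas_basis_inv x n k : (k <= n)%N ->
  lupas_basis q^-1 (1 - x) n (n - k) = lupas_basis q x n k.
Proof.
move=> kn; rewrite /lupas_basis /qbinom subKn//.
rewrite -!qfact_inv -lupas_denominator_inv subKr exprVn.
have pf m := lt0r_neq0 (qfact_gt0 m (ltW p0)).
(* Here [x] is any real, so the denominator may vanish; both sides are then 0 because the inverse of
   0 is 0. *)
have [->|Pneq0] := eqVneq (\prod_(1 <= j < n) (x + q^-1 ^+ j * (1 - x))) 0.
  by rewrite mulr0 invr0 !mulr0.
by field; rewrite !pf !qX0 Pneq0.
Qed.

Lemma lupas_reflection n f x : (0 < n)%N ->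
  lupas n q f x = lupas n q^-1 (fun y => f (1 - y)) (1 - x).
Proof.
move=> n0; rewrite /lupas [RHS]big_nat_rev; apply: eq_big_nat => k /andP[_ kn].
rewrite add0n subSS -/(lupas_basis _ _ _ _) -/(lupas_basis _ _ _ _).
by rewrite lupas_basis_inv// lupas_node_inv.
Qed.

Lemma limit_lupas_reflection f x : 1 <= q ->
  limit_lupas q f x = limit_lupas q^-1 (fun y => f (1 - y)) (1 - x).
Proof.
rewrite le_eqVlt => /predU1P[<-|q1].
  by rewrite invr1 /limit_lupas ltxx eqxx subKr.
have p1 : q^-1 < 1 by rewrite invf_lt1.
by rewrite /limit_lupas p1 ltNge ltW//= gt_eqF.
Qed.

End Reflection.

(** * The error estimate in terms of the second modulus *)

Section Error.
Variable R : realType.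
Implicit Types (f g : R -> R) (q t w x : R) (n m : nat).

Lemma lupas_error q n m g w x : 0 < q -> q <= 1 -> (0 < n)%N -> (0 < m)%N ->
  0 <= x <= 1 -> {within `[0, 1], continuous g} ->
  (forall x h, 0 <= h <= m%:R^-1 -> 0 <= x -> x + 2 * h <= 1 ->
    `|g (x + 2 * h) - 2 * g (x + h) + g x| <= w) ->
  `|lupas n q g x - limit_lupas q g x| <=
    (4 + m%:R ^+ 2 * (q ^+ n / qint q n) / 2) * w.
Proof.
move=> q0 q1 n0 m0 x01 cg gw; rewrite /limit_lupas.
have [qlt1|qge1] := ltP q 1.
  have mB := limit_lupas_lt1_mean q0 qlt1 x01.
  apply: (mean_difference (lupas_positive_mean q0 x01 n0) mB m0 _ _ _ cg gw).
  - by rewrite lupas_id// limit_lupas_lt1_id.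
  - by move=> c; exact: limit_lupas_lt1_hinge.
  - exact: lupas_sqr_limit.
have qE : q = 1 by apply/le_anti; rewrite q1.
rewrite qE eqxx; rewrite qE in q0.
apply: (mean_difference (lupas_positive_mean q0 x01 n0) (point_mean x01) m0
  _ _ _ cg gw).
- by rewrite lupas_id.
- move=> c; apply: (le_mean_hinge c (lupas_positive_mean q0 x01 n0)).
  exact: lupas_id.
(* For q = 1 the gap of second moments is x (1 - x) / [n], at most 1 / [n]. *)
rewrite lupas_sqr// mul1r subrK divr1 expr1n div1r.
have : 0 <= (qint (1 : R) n)^-1 by rewrite invr_ge0 ltW// qint_gt0.
have : x * (1 - x) <= 1 by move/andP: x01 => [? ?]; nra.
move=> V1 W; have := ler_piMr W V1; move/andP: x01; lra.
Qed.

Lemma continuous01_reflection f : {within `[0, 1], continuous f} ->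
  {within `[0, 1], continuous (fun x => f (1 - x))}.
Proof.
move/subspace_continuousP => cf; apply/subspace_continuousP => x.
rewrite /= in_itv/= => /andP[x0 x1].
apply: (@cvg_comp _ _ _ (fun x => 1 - x) f _ (within `[0, 1] (nbhs (1 - x)))); last first.
  by apply: cf; rewrite /= in_itv/=; apply/andP; split; lra.
have c1 : (fun y : R => 1 - y) @ x --> 1 - x.
  by apply: cvgB; [exact: cvg_cst|exact: cvg_id].
move=> P /c1 xP; apply: (@filterS R (nbhs x) _ _ _ _ xP).
move=> y yP; rewrite /= in_itv/= => /andP[y0 y1]; apply: yP.
by rewrite /= in_itv/=; apply/andP; split; lra.
Qed.

Lemma omega2_second_difference g t w x h : omega2 g t = w%:E ->
  0 <= h <= t -> 0 <= x -> x + 2 * h <= 1 ->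
  `|g (x + 2 * h) - 2 * g (x + h) + g x| <= w.
Proof.
move=> gw ht x0 xh; rewrite -lee_fin -gw.
apply: le_ereal_sup_tmp; eexists; first by exists h => //; split=> //; lra.
by apply: ereal_sup_ubound; exists x => //; rewrite /= in_itv/= x0; lra.
Qed.

Lemma omega2_ge0 g t : 0 <= t -> (0 <= omega2 g t)%E.
Proof.
move=> t0; apply: le_ereal_sup_tmp; eexists.
  by exists 0 => //; split; rewrite ?mulr0 ?lexx.
apply: le_ereal_sup_tmp; eexists.
  by exists 0 => //; rewrite /= in_itv/= lexx mulr0 subr0 ler01.
by rewrite lee_fin.
Qed.

Lemma lupas_error_omega2 f q n t : let g := fun x => f (1 - x) in
  1 <= q -> (0 < n)%N -> 0 < t -> t <= 1 ->
  q^-1 ^+ n / qint q^-1 n <= t ^+ 2 -> {within `[0, 1], continuous f} ->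
  (supnorm01 (fun x => lupas n q f x - limit_lupas q f x)%R <= 6%:E * omega2 g t)%E.
Proof.
move=> g q1 n0 t0 t1 lamt cf.
have q0 : 0 < q by apply: lt_le_trans q1.
have p0 : 0 < q^-1 by rewrite invr_gt0.
have p1 : q^-1 <= 1 by rewrite invf_le1.
have cg : {within `[0, 1], continuous g} by exact: continuous01_reflection.
(* An infinite modulus makes the bound trivial; otherwise its value serves as [w]. *)
case E : (omega2 g t) (omega2_ge0 g (ltW t0)) => [w| |] //; last first.
  by move=> _; rewrite gt0_muley ?leey// lte_fin.
rewrite lee_fin => w0.
(* This [m] lies between 1/t and 2/t: steps up to 1/m are covered by the modulus at [t], and m^2 t^2
   <= 4 gives the constant 4 + 4/2 = 6. *)
pose m := (Num.truncn t^-1).+1.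
have ti1 : 1 <= t^-1 by rewrite invf_ge1.
have ti0 : 0 <= t^-1 by rewrite (le_trans ler01).
have mt : t^-1 <= m%:R by rewrite ltW// truncnS_gt.
have mle : m%:R <= 2 * t^-1.
  have : (Num.truncn t^-1)%:R <= t^-1 by rewrite truncn_le.
  by rewrite /m -natr1; lra.
have minv : m%:R^-1 <= t by rewrite -[t]invrK lef_pV2// posrE ?invr_gt0 ?ltr0n.
apply: ge_ereal_sup => _ [x /= + <-]; rewrite in_itv/= => /andP[x0 x1].
rewrite lupas_reflection// limit_lupas_reflection// lee_fin.
have x01 : 0 <= 1 - x <= 1 by apply/andP; split; lra.
apply: le_trans (lupas_error p0 p1 n0 (ltn0Sn _ : 0 < m)%N x01 cg _) _.
  move=> y h /andP[h0 hm]; apply: (omega2_second_difference E).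
  by rewrite h0 (le_trans hm).
apply: ler_wpM2r => //.
suff : m%:R ^+ 2 * (q^-1 ^+ n / qint q^-1 n) <= 4 by lra.
apply: (@le_trans _ _ ((2 * t^-1) ^+ 2 * t ^+ 2)).
  apply: ler_pM => //; first by rewrite divr_ge0 ?exprn_ge0 ?qint_ge0// ltW.
  by rewrite ler_sqr// nnegrE// mulr_ge0.
by rewrite -exprMn -mulrA mulVf ?lt0r_neq0// mulr1; lra.
Qed.

End Error.

Theorem theorem16 (R : realType) :
  exists c : R, 0 < c /\
    forall (f : R -> R) (n : nat),
      {within `[0, 1], continuous f} -> (1 <= n)%N ->
      let g : R -> R := fun x => f (1 - x) in
      (forall q : R, 1 < q ->
         (supnorm01 (fun x => lupas n q f x - limit_lupas q f x)%R
          <= c%:E * omega2 g (Num.sqrt (q ^- n))%R)%E)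
      /\
      (ereal_sup [set supnorm01 (fun x => lupas n q f x - limit_lupas q f x)%R
                 | q in [set q : R | (1 <= q)%R]]
       <= c%:E * omega2 g (n%:R `^ (- (1 / 2)))%R)%E.
Proof.
exists 6; split=> // f n cf n0 g; split=> [q q1|].
  have q0 : 0 < q by apply: lt_trans q1.
  have qn0 : 0 < q ^- n by rewrite invr_gt0 exprn_gt0.
  apply: lupas_error_omega2 => //; first exact: ltW.
  - by rewrite sqrtr_gt0.
  - by rewrite -sqrtr1 ler_wsqrtr// invf_le1 ?exprn_gt0// exprn_ege1// ltW.
  have p0 : 0 <= q^-1 by rewrite invr_ge0 ltW.
  (* It remains to use that the q-integer [n] at 1/q is at least 1. *)
  rewrite sqr_sqrtr ?(ltW qn0)// exprVn ler_pdivrMr ?qint_gt0//.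
  by rewrite ler_peMr ?(ltW qn0)// qint_ge1.
apply: ge_ereal_sup => _ [q /= q1 <-].
have q0 : 0 < q by apply: lt_le_trans q1.
have nR : 0 < n%:R :> R by rewrite ltr0n.
have tE : (n%:R : R) `^ (- (1 / 2)) = (Num.sqrt n%:R)^-1.
  by rewrite powRN div1r powR12_sqrt// ltW.
apply: lupas_error_omega2 => //; rewrite tE.
- by rewrite invr_gt0 sqrtr_gt0.
- by rewrite invf_le1 ?sqrtr_gt0// -[leLHS]sqrtr1 ler_wsqrtr// ler1n.
rewrite [_ ^+ 2]exprVn sqr_sqrtr ?(ltW nR)//.
have p0 : 0 <= q^-1 by rewrite invr_ge0 ltW.
have p1 : q^-1 <= 1 by rewrite invf_le1.
rewrite ler_pdivrMr ?qint_gt0// ler_pdivlMl//.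
(* With p = 1/q <= 1, n p^n <= [n] holds because each of the n terms p^i of [n] is at least p^n. *)
rewrite /qint mulr_natl -[n in _ *+ n](subn0 n) -sumr_const_nat.
rewrite big_nat [leRHS]big_nat; apply: ler_sum => i /andP[_ ni].
by apply: ler_wiXn2l => //; exact: ltnW.
Qed.
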